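(* For every $N\in\mathbb{N}$, $\mathrm{Dec}_N=\mathrm{CP}_N+\mathrm{coCP}_N=(\mathrm{CP}_N\cap\mathrm{coCP}_N)^*$, where $(\mathcal{K})^*=\{|\mu\rangle\in(\mathbb{R}^4)^{\otimes N}:\langle\mu|\kappa\rangle\ge0\ \forall|\kappa\rangle\in\mathcal{K}\}$ with the Euclidean inner product. In particular, a Pauli diagonal map is decomposable iff it is the sum of a completely positive Pauli diagonal map and a completely copositive Pauli diagonal map.
   Context: Pauli matrices $\sigma_1=I_2$, $\sigma_2=\begin{pmatrix}0&1\\1&0\end{pmatrix}$, $\sigma_3=\begin{pmatrix}1&0\\0&-1\end{pmatrix}$, $\sigma_4=\begin{pmatrix}0&-i\\i&0\end{pmatrix}$. For $|\mu\rangle\in(\mathbb{R}^4)^{\otimes N}$, $\Pi^{(N)}_\mu(X)=\sum_{i_1,\dots,i_N}\frac{\mu_{i_1\cdots i_N}}{2^N}\mathrm{Tr}[(\sigma_{i_1}\otimes\cdots\otimes\sigma_{i_N})X]\sigma_{i_1}\otimes\cdots\otimes\sigma_{i_N}$ on $\mathcal{M}_2^{\otimes N}$. $\mathrm{CP}_N$ (resp. $\mathrm{coCP}_N$) is the set of $|\mu\rangle$ such that $\Pi^{(N)}_\mu$ (resp. $\vartheta_2^{\otimes N}\circ\Pi^{(N)}_\mu$, $\vartheta_2$ the transpose) is completely positive. $\mathrm{Dec}_N$ is the set of $|\mu\rangle$ such that $\Pi^{(N)}_\mu=T+\vartheta_2^{\otimes N}\circ S$ for some completely positive maps $T,S:\mathcal{M}_2^{\otimes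 N}\to\mathcal{M}_2^{\otimes N}$ (not required to be Pauli diagonal). *)

(* Defs.v *)
From mathcomp Require Import all_boot all_algebra reals complex.
Set Implicit Arguments. Unset Strict Implicit. Unset Printing Implicit Defensive.
Import GRing.Theory Num.Theory.
Local Open Scope ring_scope.

Definition psdF (C : numClosedFieldType) (T : finType) (A : T -> T -> C) : Prop :=
  forall v : T -> C, 0 <= \sum_(x : T) \sum_(y : T) Num.conj (v x) * A x y * v y.

(* The element of M_k (x) M_d with blocks X i j, as a matrix indexed by 'I_k * 'I_d. *)
Definition block_of (C : numClosedFieldType) (k d : nat)
  (X : 'I_k -> 'I_k -> 'M[C]_d) : ('I_k * 'I_d) -> ('I_k * 'I_d) -> C :=
  fun p q => X p.1 q.1 p.2 q.2.

Definition completely_positive (C : numClosedFieldType) (d : nat)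
  (Phi : 'M[C]_d -> 'M[C]_d) : Prop :=
  forall (k : nat) (X : 'I_k -> 'I_k -> 'M[C]_d),
    psdF (block_of X) -> psdF (block_of (fun i j => Phi (X i j))).

(* Pauli matrices; index 0,1,2,3 stands for sigma_1..sigma_4 of the paper. *)
Definition pauli (C : numClosedFieldType) (i : 'I_4) : 'M[C]_2 :=
  match val i with
  | 0 => \matrix_(a, b) (if a == b then 1 else 0)
  | 1 => \matrix_(a, b) (if a == b then 0 else 1)
  | 2 => \matrix_(a, b) (if a == b then (if val a == 0 then 1 else -1) else 0)
  | _ => \matrix_(a, b) (if a == b then 0 else if val a == 0 then - 'i else 'i)
  end.

(* (C^2)^{(x)N} is identified with C^(2^N) through binary expansion:
   basis index a : 'I_(2^N) has k-th tensor factor equal to the k-th bit of a. *)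
Definition qbit (N : nat) (a : 'I_(2 ^ N)) (k : 'I_N) : 'I_2 :=
  inord (nat_of_bool (odd (a %/ 2 ^ k))).

Definition pauli_str (C : numClosedFieldType) (N : nat) (s : {ffun 'I_N -> 'I_4})
  : 'M[C]_(2 ^ N) :=
  \matrix_(a, b) \prod_(k < N) pauli C (s k) (qbit a k) (qbit b k).

(* Pauli diagonal map Pi^(N)_mu, mu in (R^4)^{(x)N} ~ functions on {ffun 'I_N -> 'I_4}. *)
Definition pauli_diag (R : realType) (N : nat) (mu : {ffun 'I_N -> 'I_4} -> R)
  (X : 'M[R[i]]_(2 ^ N)) : 'M[R[i]]_(2 ^ N) :=
  \sum_(s : {ffun 'I_N -> 'I_4})
     ((real_complex R (mu s)) / (2 ^ N)%:R * \tr (pauli_str R[i] s *m X))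
       *: pauli_str R[i] s.

Definition CP_N (R : realType) (N : nat) (mu : {ffun 'I_N -> 'I_4} -> R) : Prop :=
  completely_positive (pauli_diag mu).

(* theta_2^{(x)N} is the full transpose of M_(2^N). *)
Definition coCP_N (R : realType) (N : nat) (mu : {ffun 'I_N -> 'I_4} -> R) : Prop :=
  completely_positive (fun X => (pauli_diag mu X)^T).

Definition Dec_N (R : realType) (N : nat) (mu : {ffun 'I_N -> 'I_4} -> R) : Prop :=
  exists (T S : {linear 'M[R[i]]_(2 ^ N) -> 'M[R[i]]_(2 ^ N)}),
    [/\ completely_positive T, completely_positive S &
        forall X, pauli_diag mu X = T X + (S X)^T].

Definition inner (R : realType) (N : nat) (mu kappa : {ffun 'I_N -> 'I_4} -> R) : R :=
  \sum_(s : {ffun 'I_N -> 'I_4}) mu s * kappa s.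

Definition dual_cone (R : realType) (N : nat) (K : ({ffun 'I_N -> 'I_4} -> R) -> Prop)
  (mu : {ffun 'I_N -> 'I_4} -> R) : Prop :=
  forall kappa, K kappa -> 0 <= inner mu kappa.

(* Main.v *)
Require Import Defs.
From HB Require Import structures.
From mathcomp Require Import all_boot all_order all_algebra boolp reals complex ring.
Import Order.TTheory GRing.Theory Num.Theory.
Local Open Scope ring_scope.
Set Implicit Arguments. Unset Strict Implicit. Unset Printing Implicit Defensive.

(** Let [P t] be the Pauli strings, [d = 2 ^ N] and let [chi s t] be the sign with
[P t * P s * P t = chi s t * P s].  Then
[Pi_mu X = d^-2 * sum_t (chi mu)_t * P t * X * P t], and evaluating the Choi matrix
at the vectorizations of the [P t] shows that [Pi_mu] is completely positive iff
[chi mu >= 0]; since [P s ^T = eps s * P s] with [eps s = +-1], [coCP_N] is [eps]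
times [CP_N].  As [chi * chi = d^2], both are self-dual simplicial cones, and Farkas'
lemma gives [(CP_N /\ coCP_N)^* = CP_N + coCP_N].  Finally, for an arbitrary
completely positive [T] the Pauli-diagonal part [s |-> tr (P s * T (P s))] has
nonnegative [chi]-transform, by the same Choi-matrix evaluation, so a decomposable
[mu] pairs nonnegatively with [CP_N /\ coCP_N]. *)

(** * Farkas' lemma over an ordered field *)

(** Induction on [m]. If the first [m] constraints already force [b] to be nonnegative, [A m] gets
    coefficient 0. Otherwise a violating [y] gives a direction along which everything is projected
    onto the kernel of [A m], leaving [m] constraints. *)
Lemma farkas_ord (F : realFieldType) (I : finType) (m : nat)
    (A : nat -> I -> F) (b : I -> F) :
  (forall y : I -> F, (forall j, (j < m)%N -> 0 <= \sum_i A j i * y i) ->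
     0 <= \sum_i b i * y i) ->
  exists x : nat -> F, (forall j, 0 <= x j) /\
    forall i, b i = \sum_(j < m) x j * A j i.
Proof.
elim: m A b => [|m IHm] A b Hb.
  exists (fun=> 0); split=> // i; rewrite big_ord0.
  have sq_ge0 k : 0 <= b k ^+ 2 by exact: sqr_ge0.
  (* With no constraint, testing at [- b] gives [- |b|^2 >= 0], hence [b = 0]. *)
  have := Hb (fun k => - b k) (fun j => ltac:(by [])).
  under eq_bigr do rewrite mulrN -expr2.
  rewrite sumrN oppr_ge0 => le0.
  have /eqP : \sum_k b k ^+ 2 = 0 by apply/le_anti; rewrite le0 sumr_ge0.
  rewrite psumr_eq0 // => /allP /(_ i (mem_index_enum _)) /=.
  by rewrite sqrf_eq0 => /eqP.
have [Hm|/existsNP [y /not_implyP [Ay /negP]]] :=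
  pselect (forall y : I -> F, (forall j, (j < m)%N -> 0 <= \sum_i A j i * y i) ->
     0 <= \sum_i b i * y i).
  have [x [x_ge0 bE]] := IHm _ _ Hm.
  exists (fun j => if (j < m)%N then x j else 0); split=> [j|i]; first by case: ifP.
  rewrite big_ord_recr /= ltnn mul0r addr0 bE.
  by apply: eq_bigr => j _; rewrite ltn_ord.
rewrite -ltNge => by_lt0.
have Amy : \sum_i A m i * y i < 0.
  rewrite ltNge; apply/negP => Amy; move: by_lt0; rewrite ltNge Hb // => j.
  by rewrite ltnS leq_eqVlt => /predU1P[->//|/Ay].
(* Normalization to [A_m(z) = 1]; since [c < 0], the signs of the other forms at [y] are reversed at
   [z]. *)
pose c := (\sum_i A m i * y i)^-1; pose z i := c * y i.
have c_lt0 : c < 0 by rewrite invr_lt0.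
have dotz (f : I -> F) : \sum_i f i * z i = c * \sum_i f i * y i.
  by rewrite mulr_sumr; apply: eq_bigr => i _; rewrite /z mulrCA.
have Amz : \sum_i A m i * z i = 1 by rewrite dotz mulVf // lt_eqF.
have Az j : (j < m)%N -> \sum_i A j i * z i <= 0.
  by move=> /Ay ?; rewrite dotz mulr_le0_ge0 // ltW.
have bz : 0 < \sum_i b i * z i by rewrite dotz nmulr_lgt0.
(* The forms [f - f(z) A_m] are the pull-backs of [f] along the projection
   [w |-> w - A_m(w) z] onto the kernel of [A_m]. *)
pose pb (f : I -> F) i := f i - (\sum_k f k * z k) * A m i.
have pbE f w : \sum_i pb f i * w i
    = \sum_i f i * (w i - (\sum_k A m k * w k) * z i).
  rewrite /pb; under eq_bigr do rewrite mulrBl -mulrA.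
  under [RHS]eq_bigr do rewrite mulrBr mulrCA.
  by rewrite !sumrB -!mulr_sumr mulrC.
have [|x [x_ge0 bE]] := IHm (fun j => pb (A j)) (pb b).
  move=> w Hw; rewrite pbE; apply: Hb => j.
  rewrite ltnS leq_eqVlt => /predU1P[->|/Hw]; last by rewrite pbE.
  under eq_bigr do rewrite mulrBr mulrCA.
  by rewrite sumrB -mulr_sumr Amz mulr1 subrr.
(* The coefficient of [A m] once the projections are undone: [b(z) - sum_j x_j A_j(z)], nonnegative
   because [b(z) > 0] and [A_j(z) <= 0]. *)
pose xm := \sum_i b i * z i - \sum_(j < m) x j * \sum_i A j i * z i.
exists (fun j => if (j < m)%N then x j else xm); split=> [j|i].
  case: ifP => // _; rewrite subr_ge0 (le_trans _ (ltW bz)) //.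
  by apply: sumr_le0 => k _; rewrite mulr_ge0_le0 // Az.
rewrite big_ord_recr /= ltnn.
under eq_bigr => j _ do rewrite ltn_ord.
have pb_sum : \sum_(j < m) x j * pb (A j) i = \sum_(j < m) x j * A j i
    - (\sum_(j < m) x j * \sum_k A j k * z k) * A m i.
  rewrite mulr_suml -sumrB; apply: eq_bigr => j _.
  by rewrite mulrBr mulrA.
have := bE i; rewrite pb_sum {1}/pb /xm => bEi.
by rewrite -[LHS](subrK ((\sum_k b k * z k) * A m i)) bEi; ring.
Qed.

Lemma farkas (F : realFieldType) (I J : finType) (A : J -> I -> F) (b : I -> F) :
  (forall y : I -> F, (forall j, 0 <= \sum_i A j i * y i) ->
     0 <= \sum_i b i * y i) ->
  exists x : J -> F, (forall j, 0 <= x j) /\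
    forall i, b i = \sum_j x j * A j i.
Proof.
move=> Hb.
pose A' (k : nat) i := if insub k is Some l then A (@enum_val J J l) i else 0.
have A'E (l : 'I_#|J|) i : A' l i = A (enum_val l) i by rewrite /A' valK.
have [|x [x_ge0 bE]] := @farkas_ord F I #|J| A' b.
  move=> y Hy; apply: Hb => j; have := Hy (enum_rank j) (ltn_ord _).
  by under eq_bigr do rewrite A'E enum_rankK.
exists (fun j => x (enum_rank j)); split=> // i; rewrite bE.
rewrite [RHS](reindex (@enum_val J J)) /=; last first.
  by exists enum_rank => k _; [exact: enum_valK | exact: enum_rankK].
by apply: eq_bigr => l _; rewrite A'E enum_valK.
Qed.

(** * Commutation signs and single-qubit identities *)

(** Two Pauli matrices anticommute exactly when they are distinct and neither is the identity (index
    0); otherwise they commute. *)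
Definition anticomm (i j : 'I_4) : bool :=
  [&& val i != 0%N, val j != 0%N & val i != val j].

(** The ring is a parameter because the signs serve both over [R] (cones) and over [R[i]]
    (matrices). *)
Definition chi (F : pzRingType) (N : nat) (s t : {ffun 'I_N -> 'I_4}) : F :=
  \prod_k (-1) ^+ anticomm (s k) (t k).

(** Index 3 is the only antisymmetric Pauli matrix, so this is the sign of [P s] under
    transposition. *)
Definition eps (F : pzRingType) (N : nat) (s : {ffun 'I_N -> 'I_4}) : F :=
  \prod_k (-1) ^+ (val (s k) == 3%N).

Ltac case_ord i := case: i => [[|[|[|[|//]]]] ?] //.

Section SingleQubit.
Variable C : numClosedFieldType.
Implicit Types (i j : 'I_4) (a b c e : 'I_2).

(** Fierz identity: the entrywise form of [sum_j (+-1) sigma_j X sigma_j = 2 tr(sigma_i X) sigma_i].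
    Being entrywise, it can be multiplied over the qubits. *)
Lemma pauli_fierz i a b c e :
  \sum_(j : 'I_4) (-1) ^+ anticomm i j * (pauli C j a b * pauli C j c e)
   = 2 * (pauli C i c b * pauli C i a e).
Proof.
have ii : 'i * 'i = -1 :> C by rewrite -expr2 sqrCi.
rewrite !big_ord_recl big_ord0 /pauli /anticomm.
case_ord i; case_ord a; case_ord b; case_ord c; case_ord e;
  by rewrite /= !mxE /= ?(mulrN, mulNr, ii); ring.
Qed.

Lemma pauli_trace i j :
  \sum_(a : 'I_2) \sum_(b : 'I_2) pauli C i a b * pauli C j b a = 2 *+ (i == j).
Proof.
have ii : 'i * 'i = -1 :> C by rewrite -expr2 sqrCi.
rewrite !big_ord_recl !big_ord0 /pauli.
case_ord i; case_ord j;
  by rewrite /= !mxE /= ?(mulrN, mulNr, ii); ring.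
Qed.

Lemma pauli_herm i a b : (pauli C i a b)^* = pauli C i b a.
Proof.
have conjNi : (- 'i)^* = 'i :> C by rewrite rmorphN /= conjCi opprK.
rewrite /pauli; case_ord i; case_ord a; case_ord b; rewrite /= !mxE /=;
  by rewrite ?conjNi ?conjCi ?rmorphN ?rmorph0 ?rmorph1.
Qed.

Lemma pauli_tr i a b : pauli C i b a = (-1) ^+ (val i == 3%N) * pauli C i a b.
Proof.
rewrite /pauli; case_ord i; case_ord a; case_ord b; rewrite /= !mxE /=;
  by ring.
Qed.

End SingleQubit.

(** The commutation signs form a symmetric 4 by 4 Hadamard matrix. *)
Lemma anticomm_orth (F : comPzRingType) i k :
  \sum_(j : 'I_4) (-1) ^+ anticomm i j * (-1) ^+ anticomm j k = 4 *+ (i == k) :> F.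
Proof.
rewrite !big_ord_recl big_ord0 /anticomm.
by case_ord i; case_ord k; rewrite /=; ring.
Qed.

(** * Basis indices as bit strings *)

Lemma bits_inj (N a b : nat) : (a < 2 ^ N)%N -> (b < 2 ^ N)%N ->
  (forall k, (k < N)%N -> odd (a %/ 2 ^ k) = odd (b %/ 2 ^ k)) -> a = b.
Proof.
elim: N a b => [|N IHN] a b; first by rewrite expn0 !ltnS !leqn0 => /eqP-> /eqP->.
move=> a_lt b_lt ab.
rewrite -(odd_double_half a) -(odd_double_half b).
have := ab 0%N isT; rewrite expn0 !divn1 => ->; congr (_ + _.*2)%N.
have half_lt c : (c < 2 ^ N.+1)%N -> (c./2 < 2 ^ N)%N.
  by rewrite expnSr -divn2 ltn_divLR.
apply: IHN; [exact: half_lt | exact: half_lt |] => k kN.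
by have := ab k.+1 kN; rewrite expnS !divnMA !divn2.
Qed.

Lemma qbit_bij (N : nat) :
  bijective (fun a : 'I_(2 ^ N) => [ffun k : 'I_N => qbit a k]).
Proof.
apply: inj_card_bij; last by rewrite card_ffun !card_ord.
move=> a b /ffunP ab; apply/val_inj/(bits_inj (ltn_ord a) (ltn_ord b)) => k kN.
have := congr1 val (ab (Ordinal kN)); rewrite !ffunE /qbit /=.
by rewrite !inordK ?ltnS ?leq_b1 //; do 2 case: odd.
Qed.

(** Summing over basis indices is summing over bit strings, so distributivity factors the sum into
    single-qubit sums. *)
Lemma sum_qbit (C : comPzRingType) (N : nat) (f : 'I_N -> 'I_2 -> C) :
  \sum_(a < 2 ^ N) \prod_k f k (qbit a k) = \prod_k \sum_b f k b.
Proof.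
rewrite bigA_distr_bigA /= (reindex _ (onW_bij _ (qbit_bij N))) /=.
by apply: eq_bigr => a _; apply: eq_bigr => k _; rewrite ffunE.
Qed.

Lemma prod_delta (F : comPzRingType) (I : finType) (T : eqType) (x : F)
    (s u : {ffun I -> T}) :
  \prod_k (x *+ (s k == u k)) = x ^+ #|I| *+ (s == u).
Proof.
have [->|su] := eqVneq s u.
  by under eq_bigr do rewrite eqxx; rewrite prodr_const.
have /existsP [k sk] : [exists k, s k != u k].
  rewrite -negb_forall; apply: contra su => /forallP su; apply/eqP/ffunP => k.
  exact/eqP.
by rewrite (bigD1 k) //= (negPf sk) mul0r.
Qed.

(** * Pauli strings: single-qubit identities multiplied over the factors *)

Section PauliStrings.
Variables (C : numClosedFieldType) (N : nat).
Implicit Types (s t u : {ffun 'I_N -> 'I_4}) (a b c e : 'I_(2 ^ N)).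
Notation d := ((2 ^ N)%:R : C).
Notation P := (pauli_str C).

Lemma dim_neq0 : d != 0.
Proof. by rewrite pnatr_eq0 expn_eq0. Qed.

Lemma dim_gt0 : 0 < d.
Proof. by rewrite ltr0n expn_gt0. Qed.

Lemma pauli_str_fierz s a b c e :
  \sum_t chi C s t * (P t a b * P t c e) = d * (P s c b * P s a e).
Proof.
transitivity (\prod_(k < N) (2 * (pauli C (s k) (qbit c k) (qbit b k)
      * pauli C (s k) (qbit a k) (qbit e k))) : C); last first.
  by rewrite big_split /= prodr_const card_ord -natrX !mxE big_split.
under [RHS]eq_bigr do rewrite -pauli_fierz.
rewrite bigA_distr_bigA /=; apply: eq_bigr => t _.
by rewrite !mxE -!big_split.
Qed.

Lemma chi_orth (F : comPzRingType) s u :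
  \sum_t chi F s t * chi F t u = (4 ^ N)%:R *+ (s == u).
Proof.
transitivity (\prod_(k < N) ((4 *+ (s k == u k)) : F)); last first.
  by rewrite prod_delta card_ord natrX.
under [RHS]eq_bigr do rewrite -anticomm_orth.
rewrite bigA_distr_bigA /=; apply: eq_bigr => t _.
by rewrite -big_split.
Qed.

Lemma pauli_str_trace s u : \tr (P s *m P u) = d *+ (s == u).
Proof.
transitivity (\prod_(k < N) ((2 *+ (s k == u k)) : C)); last first.
  by rewrite prod_delta card_ord natrX.
under [RHS]eq_bigr do rewrite -pauli_trace.
rewrite -sum_qbit; apply: eq_bigr => a _; rewrite !mxE.
rewrite -(sum_qbit (fun k y => pauli C (s k) (qbit a k) y * pauli C (u k) y (qbit a k))).
by apply: eq_bigr => b _; rewrite !mxE -big_split.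
Qed.

Lemma pauli_str_herm s a b : (P s a b)^* = P s b a.
Proof. by rewrite !mxE rmorph_prod; apply: eq_bigr => k _; exact: pauli_herm. Qed.

Lemma pauli_str_tr s : (P s)^T = eps C s *: P s.
Proof.
apply/matrixP => a b; rewrite !mxE -big_split.
by apply: eq_bigr => k _; exact: pauli_tr.
Qed.

Lemma chi_sym (F : pzRingType) s t : chi F s t = chi F t s.
Proof.
apply: eq_bigr => k _; rewrite /anticomm [val (t k) == val (s k)]eq_sym.
by congr (_ ^+ nat_of_bool _); rewrite andbCA.
Qed.

End PauliStrings.

(** * Complete positivity of Kraus forms *)

Lemma sum_pair2 (V : nmodType) (I J : finType) (g : I * J -> I * J -> V) :
  \sum_x \sum_y g x y = \sum_i \sum_j \sum_a \sum_b g (i, a) (j, b).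
Proof.
have sum_pair (f : I * J -> V) : \sum_x f x = \sum_i \sum_a f (i, a).
  by rewrite (pair_bigA _ (fun i a => f (i, a))); apply: eq_bigr => -[].
rewrite sum_pair; apply: eq_bigr => i _; rewrite exchange_big /=.
by rewrite sum_pair; apply: eq_bigr => j _; rewrite exchange_big.
Qed.

Lemma exchange_big2 (V : nmodType) (I J : finType) (f : I -> I -> J -> J -> V) :
  \sum_i \sum_j \sum_a \sum_b f i j a b = \sum_a \sum_b \sum_i \sum_j f i j a b.
Proof.
under eq_bigr => i _.
  rewrite exchange_big; under eq_bigr do rewrite exchange_big; over.
rewrite exchange_big; apply: eq_bigr => a _ /=.
by rewrite exchange_big.
Qed.

(** As each [K t] is Hermitian, the form of the output at [v] is the [c]-weighted sum of the forms
    of the input at the vectors [w t], the images of [v] under [1 (x) K t]. *)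
Lemma kraus_cp (C : numClosedFieldType) (n : nat) (I : finType)
    (c : I -> C) (K : I -> 'M[C]_n) :
  (forall t, 0 <= c t) -> (forall t a b, (K t a b)^* = K t b a) ->
  completely_positive (fun X => \sum_t c t *: (K t *m X *m K t)).
Proof.
move=> c_ge0 K_herm k X X_psd v; rewrite /block_of.
pose w t (p : 'I_k * 'I_n) := \sum_b K t p.2 b * v (p.1, b).
suff -> : \sum_x \sum_y (v x)^* *
      (\sum_t c t *: (K t *m X x.1 y.1 *m K t)) x.2 y.2 * v y
    = \sum_t c t * \sum_x \sum_y (w t x)^* * block_of X x y * w t y.
  by apply: sumr_ge0 => t _; rewrite mulr_ge0.
transitivity (\sum_t \sum_x \sum_y c t *
    ((v x)^* * (K t *m X x.1 y.1 *m K t) x.2 y.2 * v y)).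
  rewrite [RHS]exchange_big; apply: eq_bigr => x _ /=.
  rewrite [RHS]exchange_big; apply: eq_bigr => y _ /=.
  rewrite summxE mulr_sumr mulr_suml; apply: eq_bigr => t _.
  by rewrite mxE; ring.
apply: eq_bigr => t _; rewrite mulr_sumr.
under eq_bigr => x _ do rewrite -mulr_sumr.
rewrite -!mulr_sumr; congr (_ * _).
rewrite !sum_pair2; apply: eq_bigr => i _; apply: eq_bigr => j _ /=.
transitivity (\sum_a \sum_b \sum_c' \sum_e
   (v (i, a))^* * K t a c' * X i j c' e * K t e b * v (j, b)).
  apply: eq_bigr => a _; apply: eq_bigr => b _.
  rewrite exchange_big mxE mulr_sumr mulr_suml; apply: eq_bigr => e _.
  rewrite mxE !(mulr_suml, mulr_sumr); apply: eq_bigr => c' _.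
  by ring.
rewrite exchange_big2; apply: eq_bigr => c' _; apply: eq_bigr => e _.
rewrite /w /block_of /= rmorph_sum !mulr_suml; apply: eq_bigr => a _.
rewrite mulr_sumr; apply: eq_bigr => b _.
by rewrite rmorphM /= K_herm; ring.
Qed.

(** * Diagonal Pauli coefficients of a completely positive map *)

Section Twirl.
Variables (C : numClosedFieldType) (N : nat).
Implicit Types (s t u : {ffun 'I_N -> 'I_4}) (a b c e : 'I_(2 ^ N)).
Notation d := ((2 ^ N)%:R : C).
Notation P := (pauli_str C).

(* The Choi matrix of [T] is evaluated at the vectorization of [P t]. *)
Lemma twirl_ge0 (T : {linear 'M[C]_(2 ^ N) -> 'M[C]_(2 ^ N)}) t :
  completely_positive T -> 0 <= \sum_s chi C s t * \tr (P s *m T (P s)).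
Proof.
move=> T_cp.
pose X (c e : 'I_(2 ^ N)) : 'M[C]_(2 ^ N) := delta_mx c e.
(* [X] is the unnormalized maximally entangled state; its form at [v] is [|sum_c v(c,c)|^2]. *)
have X_psd : psdF (block_of X).
  move=> v; rewrite /block_of /X.
  have -> : \sum_x \sum_y (v x)^* * delta_mx x.1 y.1 x.2 y.2 * v y
      = (\sum_c v (c, c))^* * \sum_c v (c, c).
    rewrite rmorph_sum mulr_suml.
    rewrite sum_pair2; apply: eq_bigr => c _; rewrite mulr_sumr.
    apply: eq_bigr => e _; rewrite (bigD1 c) //= (bigD1 e) //=.
    rewrite mxE !eqxx mulr1 !big1 ?addr0 // => [a ac|b be].
      by apply: big1 => b _; rewrite mxE (negPf ac) mulr0 mul0r.
    by rewrite mxE (negPf be) andbF mulr0 mul0r.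
  by rewrite mulrC mul_conjC_ge0.
pose v (p : 'I_(2 ^ N) * 'I_(2 ^ N)) := P t p.2 p.1.
have := T_cp _ X X_psd v.
(* The factor [d] is the one in [pauli_str_fierz], which turns a product of two entries of [P t]
   into a signed sum over all [P s]. *)
rewrite -(pmulr_rge0 _ (dim_gt0 C N)); congr (0 <= _).
transitivity (\sum_c \sum_e \sum_a \sum_b
    \sum_s chi C t s * (P s b a * P s c e) * T (delta_mx c e) a b).
  rewrite sum_pair2 mulr_sumr; apply: eq_bigr => c _.
  rewrite mulr_sumr; apply: eq_bigr => e _.
  rewrite mulr_sumr; apply: eq_bigr => a _.
  rewrite mulr_sumr; apply: eq_bigr => b _.
  rewrite -mulr_suml pauli_str_fierz /v /= pauli_str_herm /block_of /X /=; ring.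
symmetry.
transitivity (\sum_s \sum_c \sum_e \sum_a \sum_b
    chi C t s * (P s b a * P s c e) * T (delta_mx c e) a b).
  apply: eq_bigr => s _; rewrite chi_sym {2}[P s]matrix_sum_delta linear_sum /=.
  rewrite mulmx_sumr raddf_sum mulr_sumr; apply: eq_bigr => c _ /=.
  rewrite linear_sum mulmx_sumr raddf_sum mulr_sumr; apply: eq_bigr => e _ /=.
  rewrite linearZ /= -scalemxAr mxtraceZ mxtrace_mulC mulrA /mxtrace mulr_sumr.
  apply: eq_bigr => a _; rewrite [(_ *m _) a a]mxE mulr_sumr; apply: eq_bigr => b _.
  by ring.
rewrite exchange_big; apply: eq_bigr => c _ /=.
rewrite exchange_big; apply: eq_bigr => e _ /=.
rewrite exchange_big; apply: eq_bigr => a _ /=.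
by rewrite exchange_big.
Qed.

Lemma chi_inv (f : {ffun 'I_N -> 'I_4} -> C) s :
  (4 ^ N)%:R * f s = \sum_t (\sum_u chi C t u * f u) * chi C s t.
Proof.
under eq_bigr => t _ do rewrite mulr_suml.
rewrite exchange_big /= (bigD1 s) //= [X in _ + X]big1 ?addr0 => [|u us].
  under eq_bigr => t _ do rewrite mulrAC [_ * chi C s t]mulrC.
  by rewrite -mulr_suml chi_orth eqxx.
under eq_bigr => t _ do rewrite mulrAC [_ * chi C s t]mulrC.
by rewrite -mulr_suml chi_orth eq_sym (negPf us) mul0r.
Qed.

(** Parseval: up to [4 ^ N], the pairing equals that of the two [chi]-transforms, both
    nonnegative. *)
Lemma twirl_pair_ge0 (T : {linear 'M[C]_(2 ^ N) -> 'M[C]_(2 ^ N)})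
    (f : {ffun 'I_N -> 'I_4} -> C) :
  completely_positive T -> (forall t, 0 <= \sum_u chi C t u * f u) ->
  0 <= \sum_s f s * \tr (P s *m T (P s)).
Proof.
move=> T_cp f_ge0.
have D_gt0 : 0 < (4 ^ N)%:R :> C by rewrite ltr0n expn_gt0.
rewrite -(pmulr_rge0 _ D_gt0) mulr_sumr.
under eq_bigr => s _ do rewrite mulrA chi_inv mulr_suml.
rewrite exchange_big; apply: sumr_ge0 => t _ /=.
under eq_bigr => s _ do rewrite -mulrA.
by rewrite -mulr_sumr mulr_ge0 // twirl_ge0.
Qed.

End Twirl.

(** Matrix form of [pauli_str_fierz]: signed conjugations by Pauli strings isolate the [P s]
    component of [X]. *)
Lemma pauli_conj_sum (C : numClosedFieldType) (N : nat) s (X : 'M[C]_(2 ^ N)) :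
  \sum_t chi C s t *: (pauli_str C t *m X *m pauli_str C t)
    = ((2 ^ N)%:R * \tr (pauli_str C s *m X)) *: pauli_str C s.
Proof.
pose P := @pauli_str C N; apply/matrixP => a e; rewrite summxE [RHS]mxE.
transitivity (\sum_c \sum_b X b c * \sum_t chi C s t * (P t a b * P t c e)).
  under [RHS]eq_bigr do under eq_bigr do rewrite mulr_sumr.
  under [RHS]eq_bigr do rewrite exchange_big.
  rewrite [RHS]exchange_big; apply: eq_bigr => t _ /=.
  rewrite mxE [(_ *m _) a e]mxE mulr_sumr; apply: eq_bigr => c _.
  rewrite [(_ *m _) a c]mxE mulr_suml mulr_sumr; apply: eq_bigr => b _.
  by ring.
rewrite /mxtrace mulr_sumr mulr_suml; apply: eq_bigr => c _.
rewrite [(_ *m _) c c]mxE mulr_sumr mulr_suml; apply: eq_bigr => b _.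
by rewrite pauli_str_fierz; ring.
Qed.

Lemma eps_sqr (F : comPzRingType) N (s : {ffun 'I_N -> 'I_4}) : eps F s * eps F s = 1.
Proof.
by rewrite -big_split big1 // => k _ /=; rewrite -expr2 sqrr_sign.
Qed.

(** * Pauli diagonal maps and their cones *)

Section PauliDiagonal.
Variables (R : realType) (N : nat).
Implicit Types (s t : {ffun 'I_N -> 'I_4}) (mu : {ffun 'I_N -> 'I_4} -> R).
Notation C := (R[i]).
Notation d := ((2 ^ N)%:R : C).
Notation P := (pauli_str C).
Local Notation "x %:C" := (real_complex R x) (format "x %:C").

Lemma rmorph_chi s t : (chi R s t)%:C = chi C s t.
Proof. by rewrite rmorph_prod; apply: eq_bigr => k _; rewrite rmorph_sign. Qed.

Lemma rmorph_eps s : (eps R s)%:C = eps C s.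
Proof. by rewrite rmorph_prod; apply: eq_bigr => k _; rewrite rmorph_sign. Qed.

Lemma pauli_diag_linear mu : linear (pauli_diag mu).
Proof.
move=> x A B; rewrite /pauli_diag scaler_sumr -big_split; apply: eq_bigr => s _ /=.
rewrite mulmxDr -scalemxAr mxtraceD mxtraceZ scalerA -scalerDl.
by congr (_ *: _); ring.
Qed.

(** Bundled linearity lets [pauli_diag mu] enter [twirl_ge0] and serve as a witness for [Dec_N]. *)
HB.instance Definition _ mu :=
  GRing.isLinear.Build C _ _ _ (pauli_diag mu) (pauli_diag_linear mu).

Lemma pauli_diag_tr mu X :
  (pauli_diag mu X)^T = pauli_diag (fun s => eps R s * mu s) X.
Proof.
rewrite /pauli_diag linear_sum; apply: eq_bigr => s _ /=.
rewrite linearZ /= pauli_str_tr scalerA rmorphM /= rmorph_eps.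
by congr (_ *: _); ring.
Qed.

Lemma pauli_diag_kraus mu X :
  pauli_diag mu X = \sum_t ((\sum_s chi R t s * mu s)%:C / (4 ^ N)%:R)
    *: (P t *m X *m P t).
Proof.
(* One factor [d] is the normalization of [pauli_diag], the other comes from [pauli_conj_sum]. *)
have -> : (4 ^ N)%:R = d * d by rewrite -natrM -expnMn.
transitivity (\sum_s ((mu s)%:C / (d * d))
    *: \sum_t chi C s t *: (P t *m X *m P t)).
  apply: eq_bigr => s _; rewrite pauli_conj_sum scalerA; congr (_ *: _).
  have := dim_neq0 C N; move: d => D D0.
  by field.
under eq_bigr do rewrite scaler_sumr.
rewrite exchange_big; apply: eq_bigr => t _ /=.
rewrite rmorph_sum mulr_suml scaler_suml; apply: eq_bigr => s _.
by rewrite scalerA chi_sym rmorphM /= rmorph_chi; congr (_ *: _); ring.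
Qed.

(** [P s] is an eigenvector with eigenvalue [mu s], and [tr (P s * P s) = d]. *)
Lemma pauli_diag_eigenvalue mu s : \tr (P s *m pauli_diag mu (P s)) = d * (mu s)%:C.
Proof.
rewrite /pauli_diag mulmx_sumr raddf_sum (bigD1 s) //= big1 ?addr0 => [|t ts].
  rewrite -scalemxAr mxtraceZ pauli_str_trace eqxx mulr1n.
  by rewrite divfK ?dim_neq0 // mulrC.
by rewrite -scalemxAr mxtraceZ pauli_str_trace (negPf ts) mulr0n mulr0 mul0r.
Qed.

(** Necessity is [twirl_ge0] at the eigenvalues [mu s]; sufficiency holds because the transform
    gives the Kraus weights. *)
Lemma CP_N_spectrum mu : CP_N mu <-> forall t, 0 <= \sum_s chi R t s * mu s.
Proof.
split=> [mu_cp t|mu_ge0].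
  have := @twirl_ge0 C N (pauli_diag mu) t mu_cp.
  under eq_bigr do rewrite pauli_diag_eigenvalue mulrCA chi_sym -rmorph_chi -rmorphM.
  by rewrite -mulr_sumr pmulr_rge0 ?dim_gt0 // -rmorph_sum /= lecR.
rewrite /CP_N (_ : pauli_diag mu = fun X => \sum_t
  ((\sum_s chi R t s * mu s)%:C / (4 ^ N)%:R) *: (P t *m X *m P t)); last first.
  by apply/funext => X; exact: pauli_diag_kraus.
apply: kraus_cp => [t|t a b]; last exact: pauli_str_herm.
by rewrite divr_ge0 ?ler0n // lecR.
Qed.

Lemma coCP_N_eps mu : coCP_N mu <-> CP_N (fun s => eps R s * mu s).
Proof.
rewrite /coCP_N (_ : (fun X => (pauli_diag mu X)^T) =
  pauli_diag (fun s => eps R s * mu s)) //.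
by apply/funext => X; exact: pauli_diag_tr.
Qed.

Lemma Dec_N_of_sum mu mu1 mu2 : CP_N mu1 -> coCP_N mu2 ->
  (forall s, mu s = mu1 s + mu2 s) -> Dec_N mu.
Proof.
move=> mu1_cp /coCP_N_eps mu2_cp muE.
exists (pauli_diag mu1), (pauli_diag (fun s => eps R s * mu2 s)); split=> // X.
rewrite /= -pauli_diag_tr trmxK -big_split; apply: eq_bigr => s _ /=.
by rewrite -scalerDl muE rmorphD /= !mulrDl.
Qed.

Lemma Dec_N_dual mu :
  Dec_N mu -> dual_cone (fun kappa => CP_N kappa /\ coCP_N kappa) mu.
Proof.
move=> [T [S [T_cp S_cp muE]]] kappa.
move=> [/CP_N_spectrum k_ge0 /coCP_N_eps/CP_N_spectrum ek_ge0].
have spec_ge0 (f : {ffun 'I_N -> 'I_4} -> R) :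
    (forall t, 0 <= \sum_s chi R t s * f s) ->
    forall t, 0 <= \sum_s chi C t s * (f s)%:C.
  move=> f_ge0 t; under eq_bigr do rewrite -rmorph_chi -rmorphM.
  by rewrite -rmorph_sum lecR.
rewrite -lecR -(pmulr_rge0 _ (dim_gt0 C N)).
suff -> : d * (inner mu kappa)%:C = \sum_s (kappa s)%:C * \tr (P s *m T (P s))
    + \sum_s (eps R s * kappa s)%:C * \tr (P s *m S (P s)).
  by rewrite addr_ge0 //; apply: twirl_pair_ge0 => //; exact: spec_ge0.
rewrite rmorph_sum mulr_sumr -big_split; apply: eq_bigr => s _ /=.
rewrite rmorphM /= mulrA -pauli_diag_eigenvalue muE mulmxDr mxtraceD.
(* Inside the trace the transpose moves from [S (P s)] to [P s], producing the sign [eps s]. *)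
rewrite -[\tr (P s *m (S _)^T)]mxtrace_tr trmx_mul trmxK pauli_str_tr.
rewrite -scalemxAr mxtraceZ [\tr (S _ *m _)]mxtrace_mulC.
by rewrite rmorphM /= rmorph_eps; ring.
Qed.

Lemma sum_of_dual mu : dual_cone (fun kappa => CP_N kappa /\ coCP_N kappa) mu ->
  exists mu1 mu2 : {ffun 'I_N -> 'I_4} -> R,
    [/\ CP_N mu1, coCP_N mu2 & forall s, mu s = mu1 s + mu2 s].
Proof.
move=> mu_dual.
(* The left generators cut out [CP_N] and the right ones [coCP_N], so the Farkas hypothesis is
   membership in the dual cone. *)
pose g (j : {ffun 'I_N -> 'I_4} + {ffun 'I_N -> 'I_4}) s : R :=
  match j with inl t => chi R s t | inr t => eps R s * chi R s t end.
have [|x [x_ge0 muE]] := @farkas R _ _ g mu.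
  move=> y Hy; apply: mu_dual; split.
    apply/CP_N_spectrum => t; have := Hy (inl t).
    by under eq_bigr do rewrite /g chi_sym.
  apply/coCP_N_eps/CP_N_spectrum => t; have := Hy (inr t).
  by under eq_bigr do rewrite /g chi_sym mulrAC mulrC mulrA -mulrA.
(* By orthogonality the [chi]-transform of the combination is [4 ^ N * c]: [CP_N] is generated by
   the rows that define it. *)
have cone_CP (c : {ffun 'I_N -> 'I_4} -> R) : (forall t, 0 <= c t) ->
    CP_N (fun s => \sum_t c t * chi R s t).
  move=> c_ge0; apply/CP_N_spectrum => t.
  under eq_bigr do rewrite mulr_sumr.
  rewrite exchange_big; apply: sumr_ge0 => u _ /=.
  under eq_bigr do rewrite mulrCA.
  by rewrite -mulr_sumr chi_orth mulr_ge0 // mulrn_wge0 ?ler0n.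
exists (fun s => \sum_t x (inl t) * chi R s t).
exists (fun s => eps R s * \sum_t x (inr t) * chi R s t); split.
- exact: cone_CP.
- apply/coCP_N_eps; under eq_fun do rewrite mulrA eps_sqr mul1r.
  exact: cone_CP.
move=> s; rewrite muE big_sumType /=; congr (_ + _).
by rewrite mulr_sumr; apply: eq_bigr => t _; rewrite mulrCA.
Qed.

End PauliDiagonal.

Theorem mainTheorem3 (R : realType) (N : nat) (mu : {ffun 'I_N -> 'I_4} -> R) :
  (Dec_N mu <->
     exists mu1 mu2 : {ffun 'I_N -> 'I_4} -> R,
       [/\ CP_N mu1, coCP_N mu2 & forall s, mu s = mu1 s + mu2 s])
  /\
  (Dec_N mu <-> dual_cone (fun kappa => CP_N kappa /\ coCP_N kappa) mu).
Proof.
(* The cycle is decomposable, then dual, then sum, then decomposable. *)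
have sumDec : (exists mu1 mu2 : {ffun 'I_N -> 'I_4} -> R,
    [/\ CP_N mu1, coCP_N mu2 & forall s, mu s = mu1 s + mu2 s]) -> Dec_N mu.
  by move=> [mu1 [mu2 [mu1_cp mu2_cp]]]; exact: Dec_N_of_sum.
split; split=> [/Dec_N_dual|] //; first exact: sum_of_dual.
by move/sum_of_dual/sumDec.
Qed.
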